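(* Let $\lambda=2^{5/2}$ and consider the system $$\frac{d a_j}{dt}=\lambda^{j-1}a_{j-1}^2-\lambda^{j}a_ja_{j+1}+f_j\quad (j>0),\qquad \frac{d a_0}{dt}=-a_0a_1+f_0,$$ with $f=(f_0,f_1,f_2,\dots)=(\lambda^{-1/3},0,0,\dots)$. Let $a(t)$ be a regular solution of this system on $[T_1,T_2]$, and write $a_j(t)=\lambda^{-\frac{j}{3}}+b_j(t)$, $b(t)=\{b_j(t)\}_{j\ge0}$. Then $$\|b(T_2)\|_{l^2}-\|b(T_1)\|_{l^2}\le -\frac12\,\lambda^{-\frac13}(T_2-T_1).$$
   Context: Sequences are real and indexed by $j=0,1,2,\dots$, with norms $\|a\|_{l^2}=\big(\sum_{j\ge0}a_j^2\big)^{1/2}$ and $\|a\|_{H^{s}}=\big(\sum_{j\ge 0}2^{2sj}a_j^2\big)^{1/2}$. A solution of the system on a time interval is an $l^2$-valued function $a(t)=(a_0(t),a_1(t),\dots)$ defined on that interval such that each $a_j$ is $C^1$ there and all the equations of the system hold (in the interior of the interval). A solution $a(t)$ is called regular on $[T_1,T_2]$ if $\|a(t)\|_{H^{5/6}}$ is bounded on $[T_1,T_2]$. *)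

(* Defs.v *)
From HB Require Import structures.
From mathcomp Require Import all_boot all_order all_algebra.
From mathcomp Require Import all_classical all_reals all_analysis.
Set Implicit Arguments.
Unset Strict Implicit.
Unset Printing Implicit Defensive.
Import Order.TTheory GRing.Theory Num.Theory.
Import numFieldNormedType.Exports.
Local Open Scope classical_set_scope.
Local Open Scope ring_scope.

(* The norms take the value +oo on sequences outside the space. *)
Definition l2norm (R : realType) (a : nat -> R) : \bar R :=
  sqrte (\sum_(0 <= j <oo) (a j ^+ 2)%:E)%E.

Definition Hnorm (R : realType) (s : R) (a : nat -> R) : \bar R :=
  sqrte (\sum_(0 <= j <oo) (2 `^ (2 * s * j%:R) * a j ^+ 2)%:E)%E.

(* C^1 relative to the interval I: derivatives are taken within I, hence are
   one-sided at those endpoints of I that belong to I. *)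
Definition C1_on (R : realType) (I : interval R) (f : R -> R) : Prop :=
  exists g : R -> R, {within [set` I], continuous g} /\
    forall t, t \in I ->
      (f s - f t) / (s - t) @[s --> within [set` I] t^'] --> g t.

Definition lambda (R : realType) : R := 2 `^ (5 / 2).

Definition forcing (R : realType) (j : nat) : R :=
  if j is 0%N then lambda R `^ (- (1 / 3)) else 0.

Definition dyadic_rhs (R : realType) (f : nat -> R) (a : nat -> R) (j : nat) : R :=
  match j with
  | 0%N => - (a 0%N * a 1%N) + f 0%N
  | i.+1 => lambda R ^+ i * a i ^+ 2
            - lambda R ^+ i.+1 * a i.+1 * a i.+2 + f i.+1
  end.

Definition is_solution (R : realType) (f : nat -> R) (I : interval R)
    (a : R -> nat -> R) : Prop :=
  [/\ forall t, t \in I -> (l2norm (a t) < +oo)%E,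
      forall j, C1_on I (fun t => a t j)
    & forall t j, ([set` I]°) t ->
        is_derive t 1 (fun s => a s j) (dyadic_rhs f (a t) j)].

Definition is_regular (R : realType) (I : interval R) (a : R -> nat -> R) : Prop :=
  exists M : R, forall t, t \in I -> (Hnorm (5 / 6) (a t) <= M%:E)%E.

(* Main.v *)
(* Let c = lambda^(-1/3), so that (c^j)_j is the fixed point, and rescale
   a_j = c^j y_j. The rate of change of (b_0^2 + ... + b_N^2)/2 is
   (c/2)(y_N^2 + 2 y_N y_(N+1) - 2 y_N^2 y_(N+1) - 1 - D_N), where
   D_N = (y_0 - 1)^2 + sum_(j<N) (y_(j+1) - y_j)^2. As 3 c^2 <= 1, the partial
   energy b_0^2 + ... + b_N^2 is at most 2 D_N, so its square root is at most
   1 + D_N and therefore decreases at rate at least c/2, up to the terms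
   involving y_N and y_(N+1). Regularity bounds the sum of y_j^2 uniformly in
   time, so these terms disappear after averaging over N; no exchange of limit
   and integral is needed. The square root is smoothed to sqrt(E + e^2)
   because a partial energy may vanish. *)
Require Import Defs.
From HB Require Import structures.
From mathcomp Require Import all_boot all_order all_algebra.
From mathcomp Require Import all_classical all_reals all_analysis.
From mathcomp Require Import ring lra.
Set Implicit Arguments.
Unset Strict Implicit.
Unset Printing Implicit Defensive.
Import Order.TTheory GRing.Theory Num.Theory.
Import numFieldNormedType.Exports.
Local Open Scope classical_set_scope.
Local Open Scope ring_scope.

Definition dissipation (R : realType) (y : nat -> R) (N : nat) : R :=
  (y 0%N - 1) ^+ 2 + \sum_(j < N) (y j.+1 - y j) ^+ 2.

Definition fixed_ratio (R : realType) : R := lambda R `^ (- (1 / 3)).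

(** * Algebra of the fixed point: energy balance and its control by the dissipation *)

Section fixed_point.
Context {R : realType}.
Local Notation c := (fixed_ratio R).

Lemma lambda_gt0 : 0 < lambda R.
Proof. exact: powR_gt0. Qed.

Lemma ratio_gt0 : 0 < c.
Proof. exact/powR_gt0/lambda_gt0. Qed.

Lemma ratioX (j : nat) : lambda R `^ (- (j%:R / 3)) = c ^+ j.
Proof.
have -> : - (j%:R / 3) = - (1 / 3) * j%:R :> R by ring.
by rewrite [LHS]powRrM powR_mulrn ?powR_ge0. Qed.

Lemma lambdaE : lambda R = (c ^+ 3)^-1.
Proof.
rewrite -ratioX divff ?pnatr_eq0// powRN powRr1 ?invrK//.
exact/ltW/lambda_gt0.
Qed.

(** Since c = 2^(-5/6), the weight of the H^(5/6) norm is exactly c^(-2j): regularity of a is a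
    uniform l^2 bound on y. *)
Lemma two_powR_ratio (j : nat) : 2 `^ (2 * (5 / 6) * j%:R) = (c ^+ j) ^- 2 :> R.
Proof.

rewrite -ratioX -[X in _ = X^-1]powR_mulrn ?powR_ge0// /lambda.
rewrite -[X in _ = (X `^ _)^-1]powRrM -[X in _ = X^-1]powRrM -powRN.
have -> // : 2 * (5 / 6) * j%:R = - (5 / 2 * - (j%:R / 3) * 2) :> R by field.
Qed.

(** After cubing this is 27 <= 32, because c^6 = lambda^(-2) = 2^(-5). *)
Lemma ratio2_le : 3 * c ^+ 2 <= 1.
Proof.
have c0 := ratio_gt0.
have c6 : (c ^+ 2) ^+ 3 = 32^-1.
  rewrite -exprM -ratioX -powRrM [X in _ `^ X](_ : _ = - 5%:R); last by field.
  by rewrite powRN powR_mulrn// -[in RHS](_ : 2 ^+ 5 = 32)//; ring.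
rewrite leNgt; apply/negP => h; set q := c ^+ 2 in c6 h.
have : 1 < (3 * q) ^+ 3 by rewrite exprn_egt1.
by rewrite exprMn c6; lra.
Qed.

(** As lambda = c^(-3), all powers of c cancel except one common factor c. The cubic terms then
    telescope to the boundary, and the quadratic ones group into squares of successive
    differences. *)
Lemma energy_flux (a y : nat -> R) (N : nat) :
  (forall j, a j = c ^+ j * y j) ->
  2 * (\sum_(j < N.+1) (a j - c ^+ j) * dyadic_rhs (@forcing R) a j) =
  c * (y N ^+ 2 + 2 * y N * y N.+1 - 2 * y N ^+ 2 * y N.+1
       - 1 - dissipation y N).
Proof.
move=> aE; have c0 : c != 0 by rewrite gt_eqF// ratio_gt0.
rewrite /dissipation; elim: N => [|N IH].
  rewrite big_ord_recr !big_ord0 /= -/c !aE; ring.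
have lamN : lambda R ^+ N = (c ^+ N) ^- 3 by rewrite lambdaE exprVn exprAC.
rewrite big_ord_recr mulrDr IH big_ord_recr/= [lambda R ^+ N.+1]exprS lamN lambdaE !aE.
rewrite !(exprS c).
have : c ^+ N != 0 by rewrite expf_neq0.
move: (c ^+ N) => u u0; field.
by rewrite c0 u0.
Qed.

(** The last term is counted twice so that the induction closes: the spare copy at level N pays for
    both copies at level N+1, up to the new squared difference. *)
Lemma energy_le_dissipation (y : nat -> R) (N : nat) :
  \sum_(j < N.+1) (c ^+ j * (y j - 1)) ^+ 2
    + (c ^+ N * (y N - 1)) ^+ 2 <= 2 * dissipation y N.
Proof.
have c2 := ratio2_le.
rewrite /dissipation; elim: N => [|N IH].
  rewrite big_ord_recr !big_ord0/=; lra.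
rewrite big_ord_recr/= [in leRHS]big_ord_recr/=.
suff : 2 * (c ^+ N.+1 * (y N.+1 - 1)) ^+ 2 - (c ^+ N * (y N - 1)) ^+ 2
   <= 2 * (y N.+1 - y N) ^+ 2 by lra.
set x := y N - 1; set d := y N.+1 - y N.
have -> : y N.+1 - 1 = x + d by rewrite /x/d; ring.
rewrite [c ^+ N.+1]exprS; set u := c ^+ N.
have u0 : 0 <= u ^+ 2 by rewrite sqr_ge0.
have u1 : u ^+ 2 <= 1.
  rewrite -exprM mulnC exprM exprn_ile1 ?sqr_ge0//; have := sqr_ge0 c; lra.
have h1 : 2 * (c * u * (x + d)) ^+ 2 <= 2 / 3 * (u ^+ 2 * (x + d) ^+ 2).
  have -> : 2 * (c * u * (x + d)) ^+ 2 = 2/3 * ((3 * c ^+ 2) * (u ^+ 2 * (x + d) ^+ 2)).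
    by field.
  by rewrite ler_pM2l// ler_piMl// mulr_ge0// sqr_ge0.
(* Completing the square: 2/3 (x+d)^2 - x^2 = 2 d^2 - (x - 2d)^2 / 3. *)
have h2 : 2 / 3 * (u ^+ 2 * (x + d) ^+ 2) - (u * x) ^+ 2 <= u ^+ 2 * (2 * d ^+ 2).
  have -> : 2 / 3 * (u ^+ 2 * (x + d) ^+ 2) - (u * x) ^+ 2 =
    u ^+ 2 * (2 * d ^+ 2) - (u * (x - 2 * d)) ^+ 2 / 3 by field.
  by rewrite lerBlDr lerDl divr_ge0// sqr_ge0.
apply: (le_trans (lerB h1 (lexx _))); apply: (le_trans h2).
by rewrite ler_piMl// mulr_ge0// sqr_ge0.
Qed.

End fixed_point.

(** * Bounds and limits for partial sums; continuity up to the endpoints *)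

Section sequences_of_reals.
Context {R : realType}.

Lemma dissipation_ge0 (y : nat -> R) (N : nat) : 0 <= dissipation y N.
Proof. by rewrite addr_ge0 ?sqr_ge0// sumr_ge0// => j _; exact: sqr_ge0. Qed.

Lemma dissipation_le (y : nat -> R) (N : nat) :
  dissipation y N <= 2 + 4 * \sum_(j < N.+1) y j ^+ 2.
Proof.
(* The added 2 y_N^2 strengthens the induction: it absorbs the share of y_N in the next squared
   difference, by (p - q)^2 <= 2 p^2 + 2 q^2. *)
rewrite -[leLHS]addr0; apply: (@le_trans _ _ (dissipation y N + 2 * y N ^+ 2)).
  by rewrite lerD2l mulr_ge0// sqr_ge0.
rewrite /dissipation; elim: N => [|N IH].
  rewrite big_ord0 big_ord_recr big_ord0/=; have := sqr_ge0 (y 0%N + 1); lra.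
rewrite big_ord_recr/= [in leRHS]big_ord_recr/=.
have := sqr_ge0 (y N.+1 + y N); lra.
Qed.

(** Errors whose sum over k stays below a constant C contribute only C/n to the mean; they need not
    tend to zero at a known rate. *)
Lemma cesaro_sub_le (u v : nat -> R) (l m d C : R) :
  u @ \oo --> l -> v @ \oo --> m ->
  (forall n, \sum_(k < n) (u k - v k) <= C - d * n%:R) -> l - m <= - d.
Proof.
move=> ul vm h.
have hl : arithmetic_mean (u - v) @ \oo --> l - m.
  by apply: cesaro; exact: cvgB.
have hr : (fun n => C * n.+1%:R^-1 - d) @ \oo --> C * 0 - d.
  by apply: cvgB (cvgM (cvg_cst _) (@cvg_harmonic R)) (cvg_cst _).
rewrite mulr0 sub0r in hr.
apply: (ler_cvg_to hl hr); apply: nearW => n.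
rewrite /arithmetic_mean/= seriesEord/= mulrC ler_pdivrMr ?ltr0n//.
by rewrite mulrBl divfK ?pnatr_eq0//; exact: h.
Qed.

(** Bounded partial sums make the norm finite, so [fine] does not return its default. The index
    [n.+1] matches the energy of the modes 0 to n. *)
Lemma l2norm_cvg (x : nat -> R) (K : R) :
  (forall n, \sum_(j < n) x j ^+ 2 <= K) ->
  exists2 S : R, 0 <= S & (fun n => \sum_(j < n.+1) x j ^+ 2) @ \oo --> S /\
    fine (l2norm x) = Num.sqrt S.
Proof.
move=> xK; pose s := series (fun j => x j ^+ 2).
have s_nd : nondecreasing_seq s.
  by apply: nondecreasing_series => j _ _; exact: sqr_ge0.
have s_cvg : cvgn s.
  apply: nondecreasing_is_cvgn => //; exists K => _ [n _ <-].
  by rewrite /s seriesEord; exact: xK.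
exists (limn s).
  by apply: limr_ge => //; apply: nearW => n; apply: sumr_ge0 => j _; exact: sqr_ge0.
split.
  rewrite (_ : (fun n => _) = (fun n => s n.+1)).
    by rewrite (cvg_shiftS s).
  by apply/funext => n; rewrite /s seriesEord.
rewrite /l2norm (_ : (fun n => _) = EFin \o s).
  by rewrite EFin_lim.
by apply/funext => n; rewrite /= sumEFin.
Qed.

Lemma Hnorm_bound (s M : R) (x : nat -> R) (n : nat) :
  (Hnorm s x <= M%:E)%E ->
  \sum_(j < n) 2 `^ (2 * s * j%:R) * x j ^+ 2 <= M ^+ 2.
Proof.
move=> h; have M0 : 0 <= M by rewrite -lee_fin (le_trans _ h)// sqrte_ge0.
rewrite -lee_fin -sumEFin.
pose f j := (2 `^ (2 * s * j%:R) * x j ^+ 2)%:E.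
have f0 j : (0 <= f j)%E by rewrite lee_fin mulr_ge0 ?powR_ge0 ?sqr_ge0.
rewrite (_ : (\sum_(j < n) _)%E = (\sum_(0 <= j < n) f j)%E); last first.
  by rewrite big_mkord.
apply: (le_trans (nneseries_lim_ge _ _)) => //.
have S0 : (0 <= \sum_(0 <= j <oo) f j)%E by exact: nneseries_ge0.
by rewrite EFin_expe -lee_sqrt ?expe_ge0 ?lee_fin// sqrte_sqr gee0_abs.
Qed.

Lemma C1_on_continuous (I : interval R) (f : R -> R) :
  C1_on I f -> {within [set` I], continuous f}.
Proof.
move=> [g [_ dg]]; apply/subspace_continuousP => t tI.
have cf : f s @[s --> within [set` I] t^'] --> f t.
  have st : s - t @[s --> within [set` I] t^'] --> t - t.
    apply: cvgB; last exact: cvg_cst.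
    by apply: cvg_within_filter; apply: cvg_within.
  have fE : (fun s => (f s - f t) / (s - t) * (s - t) + f t) = f.
    apply/funext => s; have [->|ne] := eqVneq s t.
      by rewrite !subrr mulr0 add0r.
    by rewrite divfK ?subr_eq0// subrK.
  rewrite -[X in X @ _]fE -[X in _ --> X]add0r -(mulr0 (g t)) -(subrr t).
  exact: cvgD (cvgM (dg t tI) st) (cvg_cst (f t)).
apply/cvgrPdist_lt => e e0; move/cvgrPdist_lt: cf => /(_ e e0).
(* The limit is over a punctured neighbourhood; the point t itself is added back by the trivial case
   s = t. *)
move=> h; suff: nbhs t [set s | [set` I] s -> `|f t - f s| < e] by [].
have {}h : nbhs t [set s | s != t -> [set` I] s -> `|f t - f s| < e] := h.
apply: (@filterS _ (nbhs t) _ _ _ _ h) => s /= hs sI.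
have [->|ne] := eqVneq s t; first by rewrite subrr normr0.
exact: hs.
Qed.

End sequences_of_reals.

(** * Slope of the smoothed norm of a truncated deviation *)

Section monotonicity.
Context {R : realType}.
Local Notation c := (fixed_ratio R).

Definition deviation (a : R -> nat -> R) (j : nat) (t : R) : R := a t j - c ^+ j.

Definition smoothed_norm (e : R) (a : R -> nat -> R) (N : nat) (t : R) : R :=
  Num.sqrt (\sum_(j < N.+1) deviation a j t ^+ 2 + e ^+ 2).

Lemma smoothed_norm_derive (e t : R) (a : R -> nat -> R) (da : nat -> R) (N : nat) :
  0 < e -> (forall j, is_derive t 1 (fun s => a s j) (da j)) ->
  is_derive t 1 (smoothed_norm e a N)
    ((\sum_(j < N.+1) deviation a j t * da j) / smoothed_norm e a N t).
Proof.
move=> e0 ha.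
pose E s := \sum_(j < N.+1) deviation a j s ^+ 2 + e ^+ 2.
have E0 : 0 < E t.
  by rewrite ltr_wpDl ?exprn_gt0// sumr_ge0// => j _; exact: sqr_ge0.
have dE : is_derive t 1 E (2 * \sum_(j < N.+1) deviation a j t * da j).
  have -> : E = \sum_(j < N.+1) (fun s => deviation a j s) ^+ 2 + cst (e ^+ 2).
    by apply/funext => s; rewrite /E fctE fct_sumE.
  have d1 j : is_derive t 1 (deviation a j) (da j).
    rewrite (_ : deviation a j = (fun s => a s j) - cst (c ^+ j))//.
    by apply: is_derive_eq; rewrite subr0.
  apply: is_derive_eq; rewrite addr0 mulr_sumr; apply: eq_bigr => j _.
  by rewrite expr1 -[LHS]/(2 * deviation a j t * da j) mulrA.
have := is_derive1_comp (is_derive1_sqrt E0) dE.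
rewrite -[smoothed_norm e a N]/(Num.sqrt \o E) => h; apply: is_derive_eq.
have S0 : Num.sqrt (E t) != 0 by rewrite gt_eqF// sqrtr_gt0.
rewrite /=; field.
exact: S0.
Qed.

Lemma smoothed_norm_continuous (e T1 T2 : R) (a : R -> nat -> R) (N : nat) :
  (forall j, {within `[T1, T2], continuous (fun s => a s j)}) ->
  {within `[T1, T2], continuous (smoothed_norm e a N)}.
Proof.
move=> ca x.
apply: continuous_cvg; first exact: sqrt_continuous.
apply: cvgD; last exact: cvg_cst.
apply: cvg_big => [|j _]; first exact: add_continuous.
have cb : {within `[T1, T2], continuous (deviation a j)}.
  by move=> z; apply: cvgB; [exact: ca|exact: cvg_cst].
exact: cvgM (cb x) (cb x).
Qed.

Lemma smoothed_norm_slope (e B : R) (a y : nat -> R) (N : nat) :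
  0 < e <= 1 -> (forall j, a j = c ^+ j * y j) -> (forall j, y j ^+ 2 <= B) ->
  (\sum_(j < N.+1) (a j - c ^+ j) * dyadic_rhs (@forcing R) a j) /
    Num.sqrt (\sum_(j < N.+1) (a j - c ^+ j) ^+ 2 + e ^+ 2) <=
  - (c / 2) + (3 + B) / e * (y N ^+ 2 + y N.+1 ^+ 2).
Proof.
move=> /andP[e0 e1] aE yB.
have c0 := @ratio_gt0 R.
have c1 : c <= 1.
  rewrite leNgt; apply/negP => c1.
  by have := @ratio2_le R; have : 1 < c ^+ 2 by [rewrite exprn_egt1]; lra.
have := energy_flux N aE; set P := \sum_(j < N.+1) _ => PE.
have := dissipation_ge0 y N; have := energy_le_dissipation y N.
set D := dissipation y N in PE *.
rewrite (eq_bigr (fun j : 'I_N.+1 => (a j - c ^+ j) ^+ 2)); last first.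
  by move=> j _; rewrite mulrBr mulr1 aE.
have : 0 <= \sum_(j < N.+1) (a j - c ^+ j) ^+ 2.
  by apply: sumr_ge0 => j _; exact: sqr_ge0.
set F := \sum_(j < N.+1) _ => F0 FD D0.
set S := Num.sqrt _.
have {}FD : F <= 2 * D by apply: le_trans FD; rewrite lerDl sqr_ge0.
have Se : e <= S.
  rewrite [leLHS](_ : e = Num.sqrt (e ^+ 2)); last by rewrite sqrtr_sqr gtr0_norm.
  by rewrite ler_wsqrtr// lerDr.
have S0 : 0 < S by exact: lt_le_trans Se.
(* F + e^2 <= 2D + 1 <= (1 + D)^2; this is where e <= 1 enters. *)
have SD : S <= 1 + D.
  rewrite [leRHS](_ : _ = Num.sqrt ((1 + D) ^+ 2)); last first.
    by rewrite sqrtr_sqr ger0_norm// addr_ge0.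
  rewrite ler_wsqrtr//.
  have : e ^+ 2 <= 1 by rewrite exprn_ile1// ltW.
  have := sqr_ge0 D; lra.
set Q := y N ^+ 2 + y N.+1 ^+ 2.
have Q0 : 0 <= Q by rewrite addr_ge0 ?sqr_ge0.
have B0 : 0 <= B by apply: le_trans (yB 0%N); exact: sqr_ge0.
(* The bound -2 y_(N+1) <= 1 + y_(N+1)^2 <= 1 + B makes the cubic term quadratic, hence summable
   over N. *)
have rQ : y N ^+ 2 + 2 * y N * y N.+1 - 2 * y N ^+ 2 * y N.+1 <= (3 + B) * Q.
  have h1 := sqr_ge0 (y N - y N.+1).
  have h2 : - (2 * y N ^+ 2 * y N.+1) <= y N ^+ 2 * (1 + B).
    have -> : - (2 * y N ^+ 2 * y N.+1) = y N ^+ 2 * - (2 * y N.+1) by ring.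
    rewrite ler_wpM2l ?sqr_ge0//.
    have := sqr_ge0 (y N.+1 + 1); have := yB N.+1; lra.
  have h3 : 0 <= B * y N.+1 ^+ 2 by rewrite mulr_ge0 ?sqr_ge0.
  have h4 := sqr_ge0 (y N); have h5 := sqr_ge0 (y N.+1).
  rewrite /Q; lra.
have hP : P <= - (c / 2) * S + (3 + B) * Q.
  have k1 : c * (1 + D - S) >= 0 by rewrite mulr_ge0 ?subr_ge0// ltW.
  have k2 : 0 <= (3 + B) * Q by rewrite mulr_ge0// addr_ge0.
  have k3 : c * (y N ^+ 2 + 2 * y N * y N.+1 - 2 * y N ^+ 2 * y N.+1) <= (3 + B) * Q.
    by apply: (le_trans (ler_wpM2l (ltW c0) rQ)); rewrite ler_piMl.
  lra.
rewrite ler_pdivrMr// (le_trans hP)// [leRHS]mulrDl lerD2l.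
(* Since S >= e, the factor S/e is at least 1 and dividing by S costs at most 1/e. *)
rewrite [leRHS](_ : _ = (3 + B) * Q * (S / e)); last by field; rewrite gt_eqF.
apply: ler_peMr; first by rewrite mulr_ge0// addr_ge0.
by rewrite ler_pdivlMr// mul1r.
Qed.

End monotonicity.

(** * Decrease summed over truncations, and square-summability of the deviation *)

Section decrease.
Context {R : realType}.
Local Notation c := (fixed_ratio R).

Lemma smoothed_norm_decrease (T1 T2 e B : R) (a : R -> nat -> R) (n : nat) :
  T1 < T2 -> 0 < e <= 1 -> is_solution (@forcing R) `[T1, T2] a ->
  (forall t m, t \in `[T1, T2] -> \sum_(j < m) (a t j / c ^+ j) ^+ 2 <= B) ->
  \sum_(N < n) (smoothed_norm e a N T2 - smoothed_norm e a N T1) <=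
  (3 + B) / e * (2 * B) * (T2 - T1) - c / 2 * (T2 - T1) * n%:R.
Proof.
move=> T12 e01 [_ aC1 aode] yB.
have e0 : 0 < e by case/andP: e01.
have a_cont j : {within `[T1, T2], continuous (fun s => a s j)}.
  exact: C1_on_continuous (aC1 j).
pose dS N t := (\sum_(j < N.+1) deviation a j t * dyadic_rhs (@forcing R) (a t) j)
  / smoothed_norm e a N t.
have dS_derive t : t \in `]T1, T2[ ->
    is_derive t 1 (\sum_(N < n) smoothed_norm e a N) (\sum_(N < n) dS N t).
  move=> tT; apply: is_derive_sum => N; apply: smoothed_norm_derive => // j.
  by apply: aode; rewrite interior_itv.
have S_cont : {within `[T1, T2], continuous (\sum_(N < n) smoothed_norm e a N)}.
  move=> x; rewrite fct_sumE; apply: cvg_big => [|N _]; first exact: add_continuous.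
  exact: smoothed_norm_continuous.
(* The mean value theorem is applied once, to the sum over N, so all slopes are taken at the same
   time t, where the boundary terms sum to at most 2B. *)
have [t tT] := MVT T12 dS_derive S_cont.
rewrite sumrB !fct_sumE => ->.
have {}tT : t \in `[T1, T2] by exact: subset_itv_oo_cc.
pose y j := a t j / c ^+ j.
have aE j : a t j = c ^+ j * y j.
  by rewrite /y mulrC divfK// expf_neq0// gt_eqF// ratio_gt0.
have yB1 j : y j ^+ 2 <= B.
  apply: le_trans (yB t j.+1 tT); rewrite big_ord_recr/= lerDr.
  by apply: sumr_ge0 => i _; exact: sqr_ge0.
have B0 : 0 <= B by apply: le_trans (yB1 0%N); exact: sqr_ge0.
have yS : \sum_(N < n) (y N ^+ 2 + y N.+1 ^+ 2) <= 2 * B.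
  rewrite big_split/= mulr2n mulrDl mul1r lerD//; first exact: yB.
  apply: le_trans (yB t n.+1 tT); rewrite big_ord_recl/= lerDr.
  exact: sqr_ge0.
rewrite [leRHS](_ : _ = ((3 + B) / e * (2 * B) - c / 2 * n%:R) * (T2 - T1)); last by ring.
rewrite ler_wpM2r ?subr_ge0 ?(ltW T12)//.
apply: (@le_trans _ _
  (\sum_(N < n) (- (c / 2) + (3 + B) / e * (y N ^+ 2 + y N.+1 ^+ 2)))).
  by apply: ler_sum => N _; exact: (@smoothed_norm_slope _ _ _ _ y).
rewrite big_split/= sumr_const card_ord -mulr_sumr -[_ *+ n]mulr_natr mulNr addrC lerD2r.
by rewrite ler_wpM2l// divr_ge0 ?addr_ge0// ltW.
Qed.

Lemma scaled_square_sum_le (M : R) (x : nat -> R) (n : nat) :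
  (Hnorm (5 / 6) x <= M%:E)%E -> \sum_(j < n) (x j / c ^+ j) ^+ 2 <= M ^+ 2.
Proof.
move=> /(Hnorm_bound n); apply: le_trans; apply: ler_sum => j _.
by rewrite two_powR_ratio expr_div_n mulrC.
Qed.

(** The dissipation lies between: the energy is at most 2 D_n, and D_n <= 2 + 4B. *)
Lemma deviation_square_sum_le (B : R) (x : nat -> R) (n : nat) :
  (forall m, \sum_(j < m) (x j / c ^+ j) ^+ 2 <= B) ->
  \sum_(j < n) (x j - c ^+ j) ^+ 2 <= 4 + 8 * B.
Proof.
move=> xB; pose y j := x j / c ^+ j.
have yE j : c ^+ j * (y j - 1) = x j - c ^+ j.
  by rewrite mulrBr mulr1 /y mulrC divfK// expf_neq0// gt_eqF// ratio_gt0.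
have energy_le : \sum_(j < n.+1) (x j - c ^+ j) ^+ 2 <= 2 * dissipation y n.
  apply: le_trans (energy_le_dissipation y n).
  under [in leRHS]eq_bigr do rewrite yE.
  by rewrite lerDl sqr_ge0.
apply: (@le_trans _ _ (2 * dissipation y n)).
  by apply: le_trans energy_le; rewrite big_ord_recr/= lerDl sqr_ge0.
have := dissipation_le y n; have : \sum_(j < n.+1) y j ^+ 2 <= B := xB n.+1.
lra.
Qed.

End decrease.

(* Since a t and (lambda^(-j/3))_j are square-summable, so is b t, and `fine`
   below is the genuine real value of the norm. *)
Theorem theorem5p1 (R : realType) (T1 T2 : R) (a b : R -> nat -> R) :
  T1 <= T2 ->
  is_solution (@forcing R) `[T1, T2] a ->
  is_regular `[T1, T2] a ->
  (forall t j, t \in `[T1, T2] -> a t j = lambda R `^ (- (j%:R / 3)) + b t j) ->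
  fine (l2norm (b T2)) - fine (l2norm (b T1))
    <= - (1 / 2 * lambda R `^ (- (1 / 3)) * (T2 - T1)).
Proof.
rewrite le_eqVlt => /predU1P[->|T12]; first by rewrite !subrr mulr0 oppr0.
move=> sol [M aM] abE; rewrite -/(fixed_ratio R).
have yM t n : t \in `[T1, T2] ->
    \sum_(j < n) (a t j / fixed_ratio R ^+ j) ^+ 2 <= M ^+ 2.
  by move=> tT; apply/scaled_square_sum_le/aM.
have bE t : t \in `[T1, T2] -> b t = fun j => deviation a j t.
  by move=> tT; apply/funext => j; rewrite /deviation abE// ratioX addrC addKr.
have b_sum t n : t \in `[T1, T2] -> \sum_(j < n) b t j ^+ 2 <= 4 + 8 * M ^+ 2.
  by move=> tT; rewrite bE//; apply: deviation_square_sum_le => m; exact: yM.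
have T1T : T1 \in `[T1, T2] by rewrite bound_itvE ltW.
have T2T : T2 \in `[T1, T2] by rewrite bound_itvE ltW.
have [S1 S1_ge0 [S1_cvg ->]] := l2norm_cvg (fun n => b_sum T1 n T1T).
have [S2 S2_ge0 [S2_cvg ->]] := l2norm_cvg (fun n => b_sum T2 n T2T).
rewrite (bE _ T1T) in S1_cvg; rewrite (bE _ T2T) in S2_cvg.
have S_cvg e t S : (fun n => \sum_(j < n.+1) deviation a j t ^+ 2) @ \oo --> S ->
    smoothed_norm e a N t @[N --> \oo] --> Num.sqrt (S + e ^+ 2).
  move=> St; apply: continuous_cvg; first exact: sqrt_continuous.
  exact: cvgD St (cvg_cst _).
(* N tends to infinity with the smoothing e fixed, since the error constant contains 1/e. *)
have smoothed_le e : 0 < e <= 1 -> Num.sqrt (S2 + e ^+ 2) - Num.sqrt (S1 + e ^+ 2) <=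
    - (fixed_ratio R / 2 * (T2 - T1)).
  move=> e01; apply: cesaro_sub_le (S_cvg e _ _ S2_cvg) (S_cvg e _ _ S1_cvg) _ => n.
  exact: smoothed_norm_decrease n T12 e01 sol yM.
rewrite lerBlDr; apply/ler_addgt0Pl => e e0.
pose d := Num.min e 1.
(* The slope bound requires smoothing at most 1, hence the minimum. Removing it costs at most d <=
   e, as sqrt(S1 + d^2) <= sqrt(S1) + d. *)
have d0 : 0 < d by rewrite lt_min e0/=.
have := smoothed_le d; rewrite d0 ge_min lexx orbT => /(_ isT) h.
have h2 : Num.sqrt S2 <= Num.sqrt (S2 + d ^+ 2) by rewrite ler_wsqrtr// lerDl sqr_ge0.
have h1 : Num.sqrt (S1 + d ^+ 2) <= Num.sqrt S1 + d.
  rewrite [leRHS](_ : _ = Num.sqrt ((Num.sqrt S1 + d) ^+ 2)); last first.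
    by rewrite sqrtr_sqr ger0_norm// addr_ge0 ?sqrtr_ge0// ltW.
  rewrite ler_wsqrtr// sqrrD sqr_sqrtr// lerD2r lerDl mulrn_wge0//.
  by rewrite mulr_ge0 ?sqrtr_ge0// ltW.
have de : d <= e by rewrite ge_min lexx.
lra.
Qed.
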